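(* Let $f$ and $g$ be topologically conjugate continuous maps of a compact metric space $(X,d)$. Then $f$ is $DC2\frac12$ if and only if $g$ is $DC2\frac12$.
   Context: Continuous maps $f,g:X\to X$ are topologically conjugate if there is a homeomorphism $h:X\to X$ with $h\circ f=g\circ h$. For a continuous map $f:X\to X$, $(x_1,x_2)\in X^2$ and $\delta>0$ put $$\Phi_{(x_1,x_2)}(\delta)=\liminf_{m\to\infty}\frac1m\#\{0\le k\le m: d(f^k(x_1),f^k(x_2))<\delta\},$$ $$\Phi^*_{(x_1,x_2)}(\delta)=\limsup_{m\to\infty}\frac1m\#\{0\le k\le m: d(f^k(x_1),f^k(x_2))<\delta\}.$$ A pair $(x_1,x_2)\in X^2$ is distributionally scrambled of type $2\frac12$ if there are positive numbers $c$ and $s$ (depending on the pair) such that $\Phi_{(x_1,x_2)}(\delta)<c<\Phi^*_{(x_1,x_2)}(\delta)$ for every $0<\delta<s$. The map $f$ is $DC2\frac12$ if there is an uncountable set $S\subset X$ such that every pair of distinct points of $S$ is distributionally scrambled of type $2\frac12$ for $f$. *)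

(* Defs.v *)
From HB Require Import structures.
From mathcomp Require Import all_boot all_order all_algebra.
From mathcomp Require Import boolp classical_sets functions cardinality reals.
From mathcomp Require Import topology normedtype sequences.

Set Implicit Arguments.
Unset Strict Implicit.
Unset Printing Implicit Defensive.

Import Order.TTheory GRing.Theory Num.Theory.
Import numFieldNormedType.Exports.

Local Open Scope classical_set_scope.
Local Open Scope ring_scope.

Definition homeomorphism (X Y : topologicalType) (h : X -> Y) : Prop :=
  continuous h /\
  exists h' : Y -> X, [/\ continuous h', cancel h h' & cancel h' h].

Definition topologically_conjugate (X : topologicalType) (f g : X -> X) : Prop :=
  exists h : X -> X, homeomorphism h /\ h \o f = g \o h.

Section DistributionalChaos.
Context {R : realType} {X : metricType R}.
Implicit Types (f : X -> X) (x : X) (delta : R).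

(* 'I_m.+1 is the range 0 <= k <= m, which has m + 1 elements, while the
   normalization is 1 / m. The term m = 0 is 0 (as 0^-1 = 0) and the sequence
   takes its values in [0, 2], so that limn_inf and limn_sup below are the
   genuine lower and upper limits. *)
Definition proximity_frequency f x1 x2 delta (m : nat) : R :=
  m%:R^-1 *
  #|[pred k : 'I_m.+1 | mdist (iter k f x1) (iter k f x2) < delta]|%:R.

Definition Phi f x1 x2 delta : R :=
  limn_inf (proximity_frequency f x1 x2 delta).

Definition Phi_star f x1 x2 delta : R :=
  limn_sup (proximity_frequency f x1 x2 delta).

Definition scrambled2half f x1 x2 : Prop :=
  exists c s : R, [/\ 0 < c, 0 < s &
    forall delta, 0 < delta -> delta < s ->
      Phi f x1 x2 delta < c /\ c < Phi_star f x1 x2 delta].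

Definition DC2half f : Prop :=
  exists S : set X, ~ countable S /\
    forall x1 x2, S x1 -> S x2 -> x1 <> x2 -> scrambled2half f x1 x2.

End DistributionalChaos.

(* Main.v *)
Require Import Defs.
From HB Require Import structures.
From mathcomp Require Import all_boot all_order all_algebra.
From mathcomp Require Import boolp classical_sets functions cardinality reals.
From mathcomp Require Import topology normedtype sequences.

(** Let [h] conjugate [f] to [g]. By compactness [h] and its inverse are
    uniformly continuous. If [d x y < e] forces [d (h x) (h y) < delta], then
    the frequencies for [g] at [delta] dominate those for [f] at [e], so that
    [c < Phi_star f e] gives [c < Phi_star g delta]. Symmetrically, if
    [d (h x) (h y) < s'] forces [d x y < s / 2], then for every [delta < s'] the
    lower frequency of [g] at [delta] is at most that of [f] at [s / 2], hence
    below [c]. Thus the image under [h] of a scrambled set is scrambled, with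
    the same constants [c]. *)

Local Open Scope classical_set_scope.
Local Open Scope ring_scope.

Import Order.TTheory GRing.Theory Num.Theory.
Import numFieldNormedType.Exports.

(** Continuity at [x] yields a radius [e] valid for all centres near [x]. The near-covering form of
    compactness turns these local radii into a single one. *)
Lemma compact_uniformly_continuous {R : realType} {X Y : metricType R}
    {h : X -> Y} {delta : R} :
  compact [set: X] -> continuous h -> 0 < delta ->
  exists2 e : R, 0 < e &
    forall x y, mdist x y < e -> mdist (h x) (h y) < delta.
Proof.
move=> /compact_near_coveringP cX ch delta0.
pose P (e : R) x := forall y, mdist x y < e -> mdist (h x) (h y) < delta.
have /cX : forall x, [set: X] x ->
    \forall x' \near x & e \near (0 : R)^'+, P e x'.
  move=> x _.
  have : \forall y \near x, mdist (h x) (h y) < delta / 2.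
    have := ch x _ (nbhsx_ballx (h x) _ (divr_gt0 delta0 (ltr0Sn _ 1))).
    by rewrite ballEmdist.
  move=> /nbhs_ballP[r /= r0 hr].
  have r20 : 0 < r / 2 by rewrite divr_gt0.
  (* Halving [r] keeps both [x'] and every [y] within [e] of [x'] inside the ball of radius [r] at
     [x]. *)
  exists (ball x (r / 2), [set e | e < r / 2]) => /=.
    by split; [exact: nbhsx_ballx | exact: nbhs_right_lt].
  move=> [x' e] /=; rewrite ballEmdist /= => -[xx' er] y x'y.
  have hxx' : mdist (h x) (h x') < delta / 2.
    apply: hr; rewrite ballEmdist /= (lt_trans xx')//.
    by rewrite gtr_pMr// invf_lt1// ltr1n.
  have hxy : mdist (h x) (h y) < delta / 2.
    apply: hr; rewrite ballEmdist /= (le_lt_trans (metric_triangle x x' y))//.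
    by rewrite [ltRHS]splitr ltrD// (lt_trans x'y).
  rewrite (le_lt_trans (metric_triangle (h x') (h x) (h y)))//.
  by rewrite [ltRHS]splitr ltrD// metric_sym.
move=> nearP.
have [e [e0 Pe]] : exists e : R, 0 < e /\ [set: X] `<=` P e.
  near (0 : R)^'+ => e; exists e; split; near: e; last exact: nearP.
  exact: nbhs_right_gt.
by exists e => // x; exact: Pe.
Unshelve. all: by end_near. Qed.

Section LimnMonotone.
Context {R : realType}.
Implicit Types u v : nat -> R.

(** Boundedness makes the tail suprema genuine and convergent, so that neither [sup] nor [lim] falls
    back on a default value. *)
Lemma ler_limn_sup u v :
  has_lbound (range u) -> has_ubound (range u) ->
  has_lbound (range v) -> has_ubound (range v) -> (forall n, u n <= v n) ->
  limn_sup u <= limn_sup v.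
Proof.
move=> lu uu lv uv le_uv.
apply: ler_lim.
- exact: cvgP (cvg_sups_inf uu lu).
- exact: cvgP (cvg_sups_inf uv lv).
apply: nearW => n; apply: ge_sup; first by exists (u n), n => /=.
move=> _ [k /= nk <-]; rewrite (le_trans (le_uv k))// ub_le_sup//; last by exists k.
exact: has_ubound_sdrop.
Qed.

Lemma ler_limn_inf u v :
  has_lbound (range u) -> has_ubound (range u) ->
  has_lbound (range v) -> has_ubound (range v) -> (forall n, u n <= v n) ->
  limn_inf u <= limn_inf v.
Proof.
move=> lu uu lv uv le_uv.
apply: ler_lim.
- exact: cvgP (cvg_infs_sup uu lu).
- exact: cvgP (cvg_infs_sup uv lv).
apply: nearW => n; apply: lb_le_inf; first by exists (v n), n => /=.
move=> _ [k /= nk <-]; rewrite (le_trans _ (le_uv k))// ge_inf//; last by exists k.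
exact: has_lbound_sdrop.
Qed.

End LimnMonotone.

Section Conjugacy.
Context {R : realType} {X : metricType R}.
Implicit Types (f g h : X -> X) (x y : X) (delta e : R).

Lemma has_lbound_proximity_frequency f x y delta :
  has_lbound (range (proximity_frequency f x y delta)).
Proof. by exists 0 => _ [n _ <-]; rewrite mulr_ge0// invr_ge0. Qed.

Lemma has_ubound_proximity_frequency f x y delta :
  has_ubound (range (proximity_frequency f x y delta)).
Proof.
exists 2 => _ [[|n] _ <-]; rewrite /proximity_frequency.
  by rewrite invr0 mul0r.
(* At time [n + 1] the count is at most [n + 2], hence at most [2 (n + 1)]. *)
rewrite ler_pdivrMl ?ltr0n// mulrC -natrM ler_nat.
by rewrite (leq_trans (max_card _))// card_ord mul2n -addnn -addn1 leq_add2l.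
Qed.

Lemma ler_proximity_frequency {f g x1 x2 y1 y2} {delta e} :
  (forall k, mdist (iter k f x1) (iter k f x2) < delta ->
             mdist (iter k g y1) (iter k g y2) < e) ->
  forall m, proximity_frequency f x1 x2 delta m <=
            proximity_frequency g y1 y2 e m.
Proof.
move=> fg m; rewrite ler_wpM2l ?invr_ge0// ler_nat.
by apply: subset_leq_card; apply/fintype.subsetP => k; exact: fg.
Qed.

Lemma iter_semiconj {f g h} : h \o f = g \o h ->
  forall k x, iter k g (h x) = h (iter k f x).
Proof. by move=> hfg; elim=> //= k IH x; rewrite IH -[RHS]/((h \o f) _) hfg. Qed.

Lemma DC2half_conjugate {f g h} {h' : X -> X} : compact [set: X] ->
  continuous h -> continuous h' -> cancel h h' -> h \o f = g \o h ->
  DC2half f -> DC2half g.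
Proof.
move=> cX ch ch' hK hfg [S [ncS scrS]]; exists (h @` S); split.
  apply: contra_not ncS; apply: sub_countable.
  have {1}-> : S = h' @` (h @` S).
    by rewrite image_comp -[LHS]image_id; apply: eq_imagel => x _; rewrite /= hK.
  exact: card_image_le.
move=> _ _ [x Sx <-] [y Sy <-] hxy.
have [|c [s [c0 s0 fcs]]] := scrS x y Sx Sy.
  by move=> xy; apply: hxy; rewrite xy.
have s20 : 0 < s / 2 by rewrite divr_gt0.
have s2s : s / 2 < s by rewrite gtr_pMr// invf_lt1// ltr1n.
(* The new threshold must not depend on [delta]. The fixed value [s / 2], strictly below [s], serves
   all [delta < s'] at once. *)
have [s' s'0 h's'] := compact_uniformly_continuous cX ch' s20.
exists c, s'; split=> // delta delta0 deltas'; split.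
  apply: le_lt_trans (fcs _ s20 s2s).1; apply: ler_limn_inf;
  do ?[exact: has_lbound_proximity_frequency
      |exact: has_ubound_proximity_frequency].
  apply: ler_proximity_frequency => k; rewrite !(iter_semiconj hfg) => hlt.
  by rewrite -[iter k f x]hK -[iter k f y]hK h's'// (lt_trans hlt).
(* Here [e] may depend on [delta]. The minimum with [s / 2] brings it into the range where the
   scrambling of [x] and [y] applies. *)
have [e e0 he] := compact_uniformly_continuous cX ch delta0.
have m0 : 0 < Num.min e (s / 2) by rewrite lt_min e0.
have ms : Num.min e (s / 2) < s by rewrite gt_min s2s orbT.
apply: lt_le_trans (fcs _ m0 ms).2 _; apply: ler_limn_sup;
  do ?[exact: has_lbound_proximity_frequency
      |exact: has_ubound_proximity_frequency].
apply: ler_proximity_frequency => k; rewrite lt_min => /andP[xye _].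
by rewrite !(iter_semiconj hfg) he.
Qed.

End Conjugacy.

Theorem theorem4 (R : realType) (X : metricType R) (f g : X -> X) :
  compact [set: X] -> continuous f -> continuous g ->
  topologically_conjugate f g ->
  DC2half f <-> DC2half g.
Proof.
move=> cX _ _ [h [[ch [h' [ch' hK h'K]]] hfg]]; split.
  exact: DC2half_conjugate cX ch ch' hK hfg.
apply: (DC2half_conjugate cX ch' ch h'K).
(* Writing [x] as [h (h' x)] and moving [g] across [h] gives [h' (g x) = f (h' x)]. *)
apply/funext => x /=; rewrite -[in LHS](h'K x).
by rewrite -[g (h _)]/((g \o h) _) -hfg /= hK.
Qed.
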